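(* Let $K/F$ be a field extension admitting an involution $\sigma\in\mathrm{Gal}(K/F)$ such that $K^\sigma=F$, where $K^\sigma=\{a\in K : a^\sigma=a\}$. Let $\Gamma$ be a totally ordered abelian group and let $\nu:K^\times\to\Gamma$ be a surjective (additive) valuation such that $\nu\circ\sigma=\nu$ and $\nu(2)=0$. Denote by $S$ and $R$ the valuation rings of $\nu$ in $K$ and $F$, respectively. Assume that $K/F$ is unramified with respect to $\nu$, i.e. $\nu(F^\times)=\Gamma$. Then two unimodular $1$-hermitian forms over $(S,\sigma)$ are isometric over $K\cong S\otimes_R F$ (i.e. over $(K,\sigma)$) if and only if they are isometric over $S$.
   Context: An involution $\sigma$ on a ring is an anti-automorphism with $\sigma\circ\sigma=\mathrm{id}$ (the identity is allowed when the ring is commutative); write $a^\sigma$ for $\sigma(a)$. An additive valuation $\nu:K^\times\to\Gamma$, extended by $\nu(0)=\infty$, satisfies $\nu(ab)=\nu(a)+\nu(b)$ and $\nu(a+b)\ge\min\{\nu(a),\nu(b)\}$. The valuation rings are $S=\{a\in K:\nu(a)\ge 0\}$ and $R=S\cap F$; since $\nu\circ\sigma=\nu$, $\sigma$ restricts to an involution of $S$, also denoted $\sigma$. A $1$-hermitian space over a ring with involution $(S,\sigma)$ is a pair $(M,h)$ where $M$ is a projective left $S$-module and $h:M\times M\to S$ is a biadditive map with $h(ax,by)=a\,h(x,y)\,b^\sigma$ and $h(x,y)=h(y,x)^\sigma$ for all $x,y\in M$ and $a,b\in S$; then $h$ is called a $1$-hermitian form. The form $h$ is unimodular if the map $\tilde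 h:M\to\mathrm{Hom}_S(M,S)$ given by $\tilde h(x)=[y\mapsto h(y,x)]$ is an isomorphism (it is additive and $\sigma$-semilinear, so this means it is bijective). Two hermitian spaces $(M,h)$ and $(M',h')$ over $(S,\sigma)$ are isometric (over $S$) if there is an isomorphism of $S$-modules $u:M\to M'$ with $h'(ux,uy)=h(x,y)$ for all $x,y\in M$. If $(K,\tau)$ is a ring with involution containing $(S,\sigma)$, then $(M,h)$ gives rise to a hermitian space $(M_K,h_K)$ over $(K,\tau)$ with $M_K=K\otimes_S M$ and $h_K(a\otimes x,b\otimes y)=a\,h(x,y)\,b^\tau$ for $x,y\in M$, $a,b\in K$. The spaces $(M,h)$ and $(M',h')$ are isometric over $(K,\tau)$ if $(M_K,h_K)$ and $(M'_K,h'_K)$ are isometric. *)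

(* Defs.v *)
From HB Require Import structures.
From mathcomp Require Import all_boot all_order all_algebra generic_quotient.
From mathcomp Require Import boolp.
Set Implicit Arguments.
Unset Strict Implicit.
Unset Printing Implicit Defensive.
Import Order.TTheory GRing.Theory Num.Theory.
Local Open Scope ring_scope.
Local Open Scope quotient_scope.

HB.mixin Record isOrderedGroup G of Num.POrderedZmodule G := {
  ordgroup_total : total (<=%R : rel G);
  ordgroup_leD2r : forall z x y : G, x <= y -> x + z <= y + z }.

#[short(type="orderedGroupType")]
HB.structure Definition OrderedGroup :=
  { G of isOrderedGroup G & Num.POrderedZmodule G }.

(* A valuation is a function on K^*: the value of [vfun] at 0 is irrelevant,
   and the convention nu(0) = oo is built into the side conditions. *)
Record valuation (K : fieldType) (G : orderedGroupType) := Valuation {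
  vfun :> K -> G;
  valuationM : forall a b, a != 0 -> b != 0 -> vfun (a * b) = vfun a + vfun b;
  valuationD : forall a b, a != 0 -> b != 0 -> a + b != 0 ->
    Order.min (vfun a) (vfun b) <= vfun (a + b) }.

Section ValuationRing.
Context (K : fieldType) (G : orderedGroupType) (nu : valuation K G).

Definition valring_pred : {pred K} := fun a => (a == 0) || (0 <= nu a).

Lemma in_valring a : (a \in valring_pred) = (a == 0) || (0 <= nu a).
Proof. by []. Qed.

Lemma valuation1 : nu 1 = 0.
Proof.
by apply: (addrI (nu 1)); rewrite -valuationM ?oner_neq0 // mulr1 addr0.
Qed.

Lemma valuationN1 : nu (- 1) = 0.
Proof.
have n0 : (-1 : K) != 0 by rewrite oppr_eq0 oner_neq0.
have e : nu (-1) + nu (-1) = 0.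
  by rewrite -valuationM // mulrNN mulr1 valuation1.
have /orP[l|l] := ordgroup_total (nu (-1)) 0.
  have := ordgroup_leD2r (nu (-1)) _ _ l; rewrite e add0r => l'.
  by apply/eqP; rewrite eq_le l l'.
have := ordgroup_leD2r (nu (-1)) _ _ l; rewrite e add0r => l'.
by apply/eqP; rewrite eq_le l l'.
Qed.

Lemma valring_subring : subring_closed valring_pred.
Proof.
have mulc a b : a \in valring_pred -> b \in valring_pred ->
    a * b \in valring_pred.
  rewrite !in_valring; have [->|a0] := eqVneq a 0; first by rewrite mul0r eqxx.
  have [->|b0] := eqVneq b 0; first by rewrite mulr0 eqxx.
  move=> /= ha hb; rewrite mulf_eq0 (negPf a0) (negPf b0) /= valuationM //.
  apply: le_trans hb _.
  by have := ordgroup_leD2r (nu b) _ _ ha; rewrite add0r.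
have opp1 : -1 \in valring_pred by rewrite in_valring valuationN1 lexx orbT.
split=> // [|a b ha]; first by rewrite in_valring valuation1 lexx orbT.
move=> /(mulc _ _ opp1); rewrite mulN1r; move: (- b) => {}b hb.
move: ha hb; rewrite !in_valring.
have [->|a0] := eqVneq a 0; first by rewrite add0r.
have [->|b0] := eqVneq b 0; first by rewrite addr0 (negPf a0).
have [//|ab0] := eqVneq (a + b) 0.
move=> /= ha hb; apply: le_trans _ (valuationD nu a0 b0 ab0).
by rewrite comparable_le_min ?ha ?hb //; exact: ordgroup_total.
Qed.

HB.instance Definition _ :=
  GRing.isSubringClosed.Build K valring_pred valring_subring.

Definition valring := {a : K | a \in valring_pred}.

HB.instance Definition _ := SubChoice.on valring.
HB.instance Definition _ := [SubChoice_isSubComNzRing of valring by <:].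

Lemma valring_map_subproof (sigma : {rmorphism K -> K})
    (nu_sigma : forall a, nu (sigma a) = nu a) (a : valring) :
  sigma (val a) \in valring_pred.
Proof. by have := valP a; rewrite !in_valring nu_sigma fmorph_eq0. Qed.

Definition valring_map (sigma : {rmorphism K -> K})
    (nu_sigma : forall a, nu (sigma a) = nu a) (a : valring) : valring :=
  exist _ (sigma (val a)) (valring_map_subproof nu_sigma a).

End ValuationRing.

Definition projective (R : nzRingType) (M : lmodType R) : Prop :=
  forall (N P : lmodType R) (p : {linear N -> P}) (f : {linear M -> P}),
    (forall y, exists x, p x = y) ->
    exists g : {linear M -> N}, forall x, p (g x) = f x.

Record hermitian_form (R : nzRingType) (s : R -> R) (M : lmodType R)
    (h : M -> M -> R) : Prop := HermitianForm {
  hermitianDl : forall x x' y, h (x + x') y = h x y + h x' y;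
  hermitianDr : forall x y y', h x (y + y') = h x y + h x y';
  hermitianZ : forall a b x y, h (a *: x) (b *: y) = a * h x y * s b;
  hermitianC : forall x y, h x y = s (h y x) }.

Record hermitian_space (R : nzRingType) (s : R -> R) (M : lmodType R)
    (h : M -> M -> R) : Prop := HermitianSpace {
  hspace_projective : projective M;
  hspace_form : hermitian_form s h }.

(* Bijectivity of x |-> [y |-> h y x] from M to Hom_R(M, R), elements of the
   latter being compared extensionally. *)
Definition unimodular (R : nzRingType) (M : lmodType R) (h : M -> M -> R) :=
  (forall x x', (forall y, h y x = h y x') -> x = x') /\
  (forall f : {linear M -> R^o}, exists x, forall y, f y = h y x).

Definition isometric (R : nzRingType) (M M' : lmodType R)
    (h : M -> M -> R) (h' : M' -> M' -> R) : Prop :=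
  exists u : {linear M -> M'},
    bijective u /\ forall x y, h' (u x) (u y) = h x y.

Section Tensor.
Context (R T : nzRingType) (i : {rmorphism R -> T}) (M : lmodType R).

(* The list [:: (a1, x1); ...; (an, xn)] stands for the formal sum
   a1 (x) x1 + ... + an (x) xn. No formal opposites are needed, as
   (-a) (x) x is opposite to a (x) x. *)
Inductive tensor_rel : seq (T * M) -> seq (T * M) -> Prop :=
| TensorRefl s : tensor_rel s s
| TensorSym s t : tensor_rel s t -> tensor_rel t s
| TensorTrans s t u : tensor_rel s t -> tensor_rel t u -> tensor_rel s u
| TensorCat s s' t t' :
    tensor_rel s s' -> tensor_rel t t' -> tensor_rel (s ++ t) (s' ++ t')
| TensorCatC s t : tensor_rel (s ++ t) (t ++ s)
| Tensor0 x : tensor_rel [:: (0, x)] [::]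
| TensorDl a b x : tensor_rel [:: (a + b, x)] [:: (a, x); (b, x)]
| TensorDr a x y : tensor_rel [:: (a, x + y)] [:: (a, x); (a, y)]
| TensorBal a c x : tensor_rel [:: (a * i c, x)] [:: (a, c *: x)].

Definition tensor_relb (s t : seq (T * M)) : bool := `[< tensor_rel s t >].

Lemma tensor_relb_refl : reflexive tensor_relb.
Proof. by move=> s; apply/asboolP; constructor. Qed.

Lemma tensor_relb_sym : symmetric tensor_relb.
Proof. by move=> s t; apply/asboolP/asboolP => /TensorSym. Qed.

Lemma tensor_relb_trans : transitive tensor_relb.
Proof.
move=> t s u /asboolP st /asboolP tu; apply/asboolP.
exact: TensorTrans st tu.
Qed.

Canonical tensor_equiv :=
  EquivRel tensor_relb tensor_relb_refl tensor_relb_sym tensor_relb_trans.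

(* T (x)_R M, with T a right R-module through i *)
Definition tensor := {eq_quot tensor_equiv}.

HB.instance Definition _ := Choice.on tensor.
HB.instance Definition _ := EqQuotient.on tensor.

Definition tens (a : T) (x : M) : tensor := \pi_tensor [:: (a, x)].

Lemma tensor_eqP (s t : seq (T * M)) :
  \pi_tensor s = \pi_tensor t <-> tensor_rel s t.
Proof.
split=> [/eqP|st]; first by rewrite eqmodE => /asboolP.
by apply/eqP; rewrite eqmodE; apply/asboolP.
Qed.

Lemma tensor_reprP (s : seq (T * M)) : tensor_rel (repr (\pi_tensor s)) s.
Proof. by apply/tensor_eqP; rewrite reprK. Qed.

Definition tensor_zero : tensor := \pi_tensor [::].
Definition tensor_add (t u : tensor) : tensor := \pi_tensor (repr t ++ repr u).
Definition tensor_scale (a : T) (t : tensor) : tensor :=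
  \pi_tensor [seq (a * p.1, p.2) | p <- repr t].
Definition tensor_opp (t : tensor) : tensor := tensor_scale (-1) t.

Lemma tensor_addE s t :
  tensor_add (\pi_tensor s) (\pi_tensor t) = \pi_tensor (s ++ t).
Proof. by apply/tensor_eqP/TensorCat; exact: tensor_reprP. Qed.

Lemma tensor_rel_scale a s t : tensor_rel s t ->
  tensor_rel [seq (a * p.1, p.2) | p <- s] [seq (a * p.1, p.2) | p <- t].
Proof.
elim=> {s t} /=.
- by move=> s; constructor.
- by move=> s t _ /TensorSym.
- by move=> s t u _ st _; apply: TensorTrans.
- by move=> s s' t t' _ ss' _ tt'; rewrite !map_cat; apply: TensorCat.
- by move=> s t; rewrite !map_cat; apply: TensorCatC.
- by move=> x; rewrite mulr0; constructor.
- by move=> b c x; rewrite mulrDr; constructor.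
- by move=> b x y; constructor.
- by move=> b c x; rewrite mulrA; constructor.
Qed.

Lemma tensor_scaleE a s :
  tensor_scale a (\pi_tensor s) = \pi_tensor [seq (a * p.1, p.2) | p <- s].
Proof. by apply/tensor_eqP/tensor_rel_scale/tensor_reprP. Qed.

Lemma tensor_addC : commutative tensor_add.
Proof. by move=> t u; apply/tensor_eqP/TensorCatC. Qed.

Lemma tensor_addA : associative tensor_add.
Proof.
elim/quotW=> t; elim/quotW=> u; elim/quotW=> v.
rewrite (tensor_addE u v) (tensor_addE t u) (tensor_addE t (u ++ v)).
by rewrite (tensor_addE (t ++ u) v) catA.
Qed.

Lemma tensor_add0 : left_id tensor_zero tensor_add.
Proof. by elim/quotW=> t; rewrite tensor_addE. Qed.

Lemma tensor_scaleDr a t u :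
  tensor_scale a (tensor_add t u)
  = tensor_add (tensor_scale a t) (tensor_scale a u).
Proof.
elim/quotW: t => t; elim/quotW: u => u.
by rewrite tensor_addE !tensor_scaleE tensor_addE map_cat.
Qed.

Lemma tensor_scaleDl a b t :
  tensor_scale (a + b) t = tensor_add (tensor_scale a t) (tensor_scale b t).
Proof.
elim/quotW: t => t; rewrite !tensor_scaleE tensor_addE.
elim: t => [|[c x] s IHs] //=.
rewrite -cat1s -tensor_addE IHs tensor_addE mulrDl.
set u := map _ s; set v := map _ s; apply/tensor_eqP.
apply: (TensorTrans (t := [:: (a * c, x); (b * c, x)] ++ (u ++ v))).
  by apply: TensorCat; constructor.
rewrite /= -cat_rcons -cats1.
apply: (TensorCat (s := [:: _]) (s' := [:: _])); first by constructor.
apply: (TensorCat (s := [:: _] ++ u) (t := v)); last by constructor.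
exact: TensorCatC.
Qed.

Lemma tensor_scale0 t : tensor_scale 0 t = tensor_zero.
Proof.
elim/quotW: t => t; rewrite tensor_scaleE; elim: t => [|[c x] s IHs] //=.
rewrite mul0r -cat1s -tensor_addE IHs tensor_addE cats0.
by apply/tensor_eqP; constructor.
Qed.

Lemma tensor_scale1 : left_id 1 tensor_scale.
Proof.
elim/quotW=> t; rewrite tensor_scaleE.
by under eq_map => p do rewrite mul1r -surjective_pairing; rewrite map_id.
Qed.

Lemma tensor_scaleA a b t :
  tensor_scale a (tensor_scale b t) = tensor_scale (a * b) t.
Proof.
elim/quotW: t => t; rewrite (tensor_scaleE b t) (tensor_scaleE (a * b) t).
rewrite (tensor_scaleE a (map _ t)) -map_comp.
by under eq_map => p do rewrite /= mulrA.
Qed.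

Lemma tensor_addN : left_inverse tensor_zero tensor_opp tensor_add.
Proof.
by move=> t; rewrite -{2}[t]tensor_scale1 -tensor_scaleDl addNr tensor_scale0.
Qed.

HB.instance Definition _ := GRing.isZmodule.Build tensor
  tensor_addA tensor_addC tensor_add0 tensor_addN.

Lemma tensor_scaleDl' t : {morph tensor_scale^~ t : a b / a + b}.
Proof. by move=> a b; apply: tensor_scaleDl. Qed.

HB.instance Definition _ := GRing.Zmodule_isLmodule.Build T tensor
  tensor_scaleA tensor_scale1 tensor_scaleDr tensor_scaleDl'.

Lemma tensDl a b x : tens (a + b) x = tens a x + tens b x.
Proof.
by rewrite [RHS]tensor_addE; apply/tensor_eqP; constructor.
Qed.

Lemma tensDr a x y : tens a (x + y) = tens a x + tens a y.
Proof.
by rewrite [RHS]tensor_addE; apply/tensor_eqP; constructor.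
Qed.

Lemma tensZ a c x : tens a (c *: x) = tens (a * i c) x.
Proof. by apply/tensor_eqP/TensorSym; constructor. Qed.

Lemma scale_tens a b x : a *: tens b x = tens (a * b) x.
Proof. by rewrite [LHS]tensor_scaleE. Qed.

Lemma pi_tensorE s : \pi_tensor s = \sum_(p <- s) tens p.1 p.2.
Proof.
elim: s => [|[a x] s IHs]; first by rewrite big_nil.
by rewrite big_cons -IHs [RHS]tensor_addE.
Qed.

Lemma tensorE (t : tensor) : t = \sum_(p <- repr t) tens p.1 p.2.
Proof. by rewrite -[LHS]reprK pi_tensorE. Qed.

Section Lift.
Context (A : zmodType) (f : T -> M -> A).

Definition tensor_lift (t : tensor) : A := \sum_(p <- repr t) f p.1 p.2.

Hypothesis fDl : forall a b x, f (a + b) x = f a x + f b x.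
Hypothesis fDr : forall a x y, f a (x + y) = f a x + f a y.
Hypothesis fZ : forall a c x, f a (c *: x) = f (a * i c) x.

Lemma tensor_lift_pi s : tensor_lift (\pi_tensor s) = \sum_(p <- s) f p.1 p.2.
Proof.
suff sumE s' t : tensor_rel s' t ->
    \sum_(p <- s') f p.1 p.2 = \sum_(p <- t) f p.1 p.2.
  exact/sumE/tensor_reprP.
elim=> {s s' t} //=.
- by move=> s t u _ -> _ ->.
- by move=> s s' t t' _ e _ e'; rewrite !big_cat /= e e'.
- by move=> s t; rewrite !big_cat /= addrC.
- move=> x; rewrite big_seq1 big_nil /=.
  by apply: (addrI (f 0 x)); rewrite -fDl !addr0.
- by move=> a b x; rewrite !big_cons !big_nil /= !addr0 fDl.
- by move=> a x y; rewrite !big_cons !big_nil /= !addr0 fDr.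
- by move=> a c x; rewrite !big_seq1 /= fZ.
Qed.

Lemma tensor_lift_tens a x : tensor_lift (tens a x) = f a x.
Proof. by rewrite tensor_lift_pi big_seq1. Qed.

Lemma tensor_liftD t u : tensor_lift (t + u) = tensor_lift t + tensor_lift u.
Proof. by rewrite [in LHS]/+%R /= tensor_lift_pi big_cat. Qed.

End Lift.

(* The form (a (x) x, b (x) y) |-> a h(x, y) tau(b), computed on arbitrary
   representatives; see [base_form_tens] and [base_form_hermitian]. *)
Definition base_form (tau : T -> T) (h : M -> M -> R) (t u : tensor) : T :=
  \sum_(p <- repr t) \sum_(q <- repr u) p.1 * i (h p.2 q.2) * tau q.1.

Section BaseForm.
Context (s : R -> R) (tau : T -> T) (h : M -> M -> R).
Hypothesis tauD : forall a b, tau (a + b) = tau a + tau b.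
Hypothesis tauM : forall a b, tau (a * b) = tau b * tau a.
Hypothesis tauK : involutive tau.
Hypothesis tau_i : forall c, tau (i c) = i (s c).
Hypothesis h_herm : hermitian_form s h.

Let hZl c x y : h (c *: x) y = c * h x y.
Proof.
have e : h x y * s 1 = h x y.
  by have := hermitianZ h_herm 1 1 x y; rewrite !scale1r mul1r.
by rewrite -[y in LHS]scale1r (hermitianZ h_herm) -mulrA e.
Qed.

Let hZr c x y : h x (c *: y) = h x y * s c.
Proof. by rewrite -[x in LHS]scale1r (hermitianZ h_herm) mul1r. Qed.

Let inner a x u := tensor_lift (fun b y => a * i (h x y) * tau b) u.

Let base_form_inner t u :
  base_form tau h t u = tensor_lift (fun a x => inner a x u) t.
Proof. by []. Qed.

Let innerDl a a' x u : inner (a + a') x u = inner a x u + inner a' x u.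
Proof.
by rewrite -big_split; apply: eq_bigr => p _ /=; rewrite !mulrDl.
Qed.

Let innerDr a x x' u : inner a (x + x') u = inner a x u + inner a x' u.
Proof.
rewrite -big_split; apply: eq_bigr => p _ /=.
by rewrite (hermitianDl h_herm) rmorphD mulrDr mulrDl.
Qed.

Let innerZ a c x u : inner a (c *: x) u = inner (a * i c) x u.
Proof.
by apply: eq_bigr => p _ /=; rewrite hZl rmorphM !mulrA.
Qed.

Let fDl a x b b' y :
  a * i (h x y) * tau (b + b') = a * i (h x y) * tau b + a * i (h x y) * tau b'.
Proof. by rewrite tauD mulrDr. Qed.

Let fDr a x b y y' :
  a * i (h x (y + y')) * tau b = a * i (h x y) * tau b + a * i (h x y') * tau b.
Proof. by rewrite (hermitianDr h_herm) rmorphD mulrDr mulrDl. Qed.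

Let fZ a x b c y :
  a * i (h x (c *: y)) * tau b = a * i (h x y) * tau (b * i c).
Proof. by rewrite hZr rmorphM tauM tau_i !mulrA. Qed.

Lemma base_form_tens a x b y :
  base_form tau h (tens a x) (tens b y) = a * i (h x y) * tau b.
Proof.
rewrite base_form_inner tensor_lift_tens //; exact: tensor_lift_tens.
Qed.

Lemma base_formDl t t' u :
  base_form tau h (t + t') u = base_form tau h t u + base_form tau h t' u.
Proof. by rewrite !base_form_inner tensor_liftD. Qed.

Lemma base_formDr t u u' :
  base_form tau h t (u + u') = base_form tau h t u + base_form tau h t u'.
Proof.
rewrite -big_split; apply: eq_bigr => p _ /=.
by apply: (@tensor_liftD _ (fun b y => _ * i (h _ y) * tau b)).
Qed.

Lemma base_form_hermitian : hermitian_form tau (base_form tau h).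
Proof.
have tau0 : tau 0 = 0 by apply: (addrI (tau 0)); rewrite -tauD !addr0.
have bl u : base_form tau h 0 u = 0.
  by apply: (addrI (base_form tau h 0 u)); rewrite -base_formDl !addr0.
have br u : base_form tau h u 0 = 0.
  by apply: (addrI (base_form tau h u 0)); rewrite -base_formDr !addr0.
have ind (P : tensor -> tensor -> Prop) :
    (forall t, P t 0) -> (forall u, P 0 u) ->
    (forall t u u', P t u -> P t u' -> P t (u + u')) ->
    (forall t t' u, P t u -> P t' u -> P (t + t') u) ->
    (forall a x b y, P (tens a x) (tens b y)) -> forall t u, P t u.
  move=> P0r P0l PDr PDl Pt t u; rewrite [t]tensorE [u]tensorE.
  apply: (big_ind (fun t => P t _)) => [|? ? ? ?|p _].
  - exact: P0l.
  - exact: PDl.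
  apply: (big_ind (P _)) => [|? ? ? ?|q _]; [exact: P0r|exact: PDr|exact: Pt].
split; [exact: base_formDl|exact: base_formDr| |].
- move=> a b; apply: ind => [t|u|t u u'|t t' u|c x d y].
  + by rewrite scaler0 !br mulr0 mul0r.
  + by rewrite scaler0 !bl mulr0 mul0r.
  + by move=> e e'; rewrite scalerDr !base_formDr e e' mulrDr mulrDl.
  + by move=> e e'; rewrite scalerDr !base_formDl e e' mulrDr mulrDl.
  + by rewrite !scale_tens !base_form_tens tauM !mulrA.
- apply: ind => [t|u|t u u'|t t' u|a x b y].
  + by rewrite br bl tau0.
  + by rewrite br bl tau0.
  + by move=> e e'; rewrite base_formDr base_formDl tauD -e -e'.
  + by move=> e e'; rewrite base_formDr base_formDl tauD -e -e'.
  + by rewrite !base_form_tens !tauM tauK tau_i -(hermitianC h_herm) mulrA.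
Qed.

End BaseForm.
End Tensor.

(* Isometry of the scalar extensions to (T, tau) along i. *)
Definition isometric_over (R T : nzRingType) (i : {rmorphism R -> T})
    (tau : T -> T) (M M' : lmodType R)
    (h : M -> M -> R) (h' : M' -> M' -> R) : Prop :=
  @isometric T (tensor i M) (tensor i M')
    (base_form (i := i) tau h) (base_form (i := i) tau h').

(* Main.v *)
From HB Require Import structures.
Require Import Defs.
From mathcomp Require Import all_boot all_order all_algebra.
From mathcomp Require Import finmap boolp classical_sets ring.
From mathcomp.multinomials Require Import monalg.
Set Implicit Arguments.
Unset Strict Implicit.
Unset Printing Implicit Defensive.
Import GRing.Theory.
Local Open Scope ring_scope.

(* Inside the K-space V = K (x) M, let L be the image of M. Since 2 is a unit
   and S is local, L has an orthogonal basis with unit values, and so has the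
   lattice of M'. An isometry over K transports the second basis to an
   orthogonal family w_1, ..., w_n of V, with unit values b_i, that need not lie
   in L. It is moved into L one vector at a time: the part of L orthogonal to
   the vectors already moved represents the next b_i integrally, because it does
   so over K (this uses that the extension is unramified), and a product of
   quasi-reflections takes w_i to a vector of L of the same value while fixing
   the vectors already moved. The resulting orthogonal basis of L has the same
   values as that of M', hence the two forms are isometric over S. *)

(** * Sesquilinear calculus for hermitian forms *)

Section HermitianTheory.
Context (R : nzRingType) (s : R -> R) (M : lmodType R) (h : M -> M -> R).
Hypothesis hh : hermitian_form s h.

Lemma herm0l y : h 0 y = 0.
Proof. by apply: (addrI (h 0 y)); rewrite -(hermitianDl hh) !addr0. Qed.

Lemma herm0r x : h x 0 = 0.
Proof. by apply: (addrI (h x 0)); rewrite -(hermitianDr hh) !addr0. Qed.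

Lemma hermZl a x y : h (a *: x) y = a * h x y.
Proof.
have := hermitianZ hh 1 1 x y; rewrite !scale1r mul1r => e.
by rewrite -[y in LHS]scale1r (hermitianZ hh) -mulrA -e.
Qed.

Lemma hermZr a x y : h x (a *: y) = h x y * s a.
Proof. by rewrite -[x in LHS]scale1r (hermitianZ hh) mul1r. Qed.

Lemma hermitian_eq0 x y : h x y = 0 -> h y x = 0.
Proof.
rewrite (hermitianC hh y) => ->.
by rewrite -(herm0l 0) -(hermitianC hh).
Qed.

Lemma herm_suml I (r : seq I) (P : pred I) F y :
  h (\sum_(i <- r | P i) F i) y = \sum_(i <- r | P i) h (F i) y.
Proof.
exact: (big_morph (h^~ y) (fun x x' => hermitianDl hh x x' y) (herm0l y)).
Qed.

Lemma herm_sumr I (r : seq I) (P : pred I) F x :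
  h x (\sum_(i <- r | P i) F i) = \sum_(i <- r | P i) h x (F i).
Proof. by apply: (big_morph (h x) (hermitianDr hh x) (herm0r x)). Qed.

End HermitianTheory.

Lemma linear_of_linear (R : nzRingType) (M N : lmodType R) (f : M -> N) :
  linear f -> exists g : {linear M -> N}, g =1 f.
Proof.
move=> fl; pose fL := GRing.isLinear.Build R M N _ f fl.
by pose g : {linear M -> N} := HB.pack f fL; exists g.
Qed.

(** * Dual bases of projective modules *)

Section DualBasis.
Context (R : nzRingType) (M : lmodType R).
Local Open Scope fset_scope.

(** The range of summation varies with [g]; since [F m 0 = 0], sums can be compared over a union of
    supports. *)
Lemma malg_sum_linear (N : lmodType R) (F : M -> R -> N) :
  (forall m, linear (F m : R^o -> N)) ->
  linear (fun g : {malg R[M]} => \sum_(m <- msupp g) F m g@_m).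
Proof.
move=> Fl.
have F0 m : F m 0 = 0.
  by have := Fl m (-1) 0 0; rewrite scaler0 addr0 scaleN1r addNr.
have wide (g : {malg R[M]}) (d : {fset M}) : msupp g `<=` d ->
    \sum_(m <- msupp g) F m g@_m = \sum_(m <- d) F m g@_m.
  move=> gd; apply: big_fset_incl => // m _ /mcoeff_outdom ->.
  exact: F0.
move=> a g g'; set d := msupp g `|` msupp g'.
rewrite !(wide _ d) ?fsubsetUl ?fsubsetUr //.
  rewrite scaler_sumr -big_split; apply: eq_bigr => m _.
  by rewrite mcoeffD mcoeffZ Fl.
by apply: fsubset_trans (msuppD_le _ _) _; apply: fsetSU; exact: msuppZ_le.
Qed.

(** A section of the free cover [{malg R[M]}] of [M] supplies the coordinates. The last clause
    accepts families [c] of infinite support, a source of functionals for the finiteness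
    argument. *)
Lemma projective_dual_basis : projective M ->
  exists (f : M -> {linear M -> R^o}) (supp : M -> {fset M}),
  [/\ forall x m, (m \in supp x) = (f m x != 0),
      forall x, x = \sum_(m <- supp x) f m x *: m &
      forall c : M -> R,
        linear (fun x => \sum_(m <- supp x) f m x * c m : R^o)].
Proof.
move=> projM.
have [|p pE] := @linear_of_linear R {malg R[M]} M
    (fun g => \sum_(m <- msupp g) g@_m *: m).
  apply: (@malg_sum_linear _ (fun m a => a *: m)) => m a b c /=.
  by rewrite scalerDl scalerA.
have [x|l lE] := @projM _ _ p (idfun : {linear M -> M}).
  exists (<< x >> : {malg R[M]}); rewrite pE msuppU oner_eq0.
  by rewrite big_seq_fset1 mcoeffUU scale1r.
have [f fE] : exists f : M -> {linear M -> R^o}, forall m x, f m x = (l x)@_m.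
  suff /choice[f fE] : forall m, exists f : {linear M -> R^o},
      forall x, f x = (l x)@_m by exists f.
  move=> m; apply: (@linear_of_linear _ _ R^o (fun x => (l x)@_m)) => a x y.
  by rewrite linearP mcoeffD mcoeffZ.
exists f, (fun x => msupp (l x)); split=> [x m|x|c a x y].
- by rewrite fE mcoeff_neq0.
- by rewrite -[LHS]lE pE; apply: eq_bigr => m _; rewrite fE.
have cl : linear (fun g : {malg R[M]} => \sum_(m <- msupp g) g@_m * c m : R^o).
  apply: (@malg_sum_linear R^o (fun m b => b * c m)) => m b b' c'.
  exact: etrans (mulrDl (b * b')%R c' _)
    (congr1 (+%R^~ _) (esym (mulrA _ _ _))).
have e z : \sum_(m <- msupp (l z)) f m z * c m
    = \sum_(m <- msupp (l z)) (l z)@_m * c m.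
  by apply: eq_bigr => m _; rewrite fE.
by rewrite !e linearP cl.
Qed.

End DualBasis.

(** * Finite dual bases from unimodularity *)

Section Finiteness.
Context (R : nzRingType) (s : R -> R) (M : lmodType R) (h : M -> M -> R).
Local Open Scope fset_scope.

(* Call m, n adjacent when some y_p pairs nontrivially with both y_m and y_n,
   where the h(-, y_m) are the coordinates of a dual basis. Every vertex has
   finitely many neighbours, and the functional attached to a maximal set of
   pairwise nonadjacent vertices is represented by a vector with only finitely
   many nonzero coordinates, so that this set is finite. *)
Lemma unimodular_finite_dual_basis :
  hermitian_space s h -> unimodular h ->
  exists r : seq (M * M), forall x, x = \sum_(p <- r) h x p.2 *: p.1.
Proof.
move=> [projM hh] [_ uh].
have [f [supp [suppE dec flin]]] := projective_dual_basis projM.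
have /choice[y fE] : forall m, exists y, forall x, f m x = h x y.
  by move=> m; apply: uh.
have sE x m : (m \in supp x) = (h x (y m) != 0) by rewrite suppE fE.
have sC m n : (m \in supp (y n)) = (n \in supp (y m)).
  by rewrite !sE; congr (~~ _); apply/eqP/eqP; apply: hermitian_eq0 hh _ _.
have decE x : x = \sum_(m <- supp x) h x (y m) *: m.
  by rewrite [LHS]dec; apply: eq_bigr => m _; rewrite fE.
pose nbr m n := exists2 p, p \in supp (y m) & n \in supp (y p).
have nbrC m n : nbr m n -> nbr n m.
  by move=> [p pm np]; exists p; rewrite sC.
have supp0 m : y m != 0 -> exists p, p \in supp (y m).
  move=> ym; have [e|[p pm]] := fset_0Vmem (supp (y m)); last by exists p.
  by move: ym; rewrite [y m]decE e big_seq_fset0 eqxx.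
have nbrr m : y m != 0 -> nbr m m.
  by move=> /supp0[p pm]; exists p; rewrite // sC.
pose indep (C : set M) := (forall m, C m -> y m != 0) /\
  forall m n, C m -> C n -> nbr m n -> m = n.
have [F FP Ftot|C [[C0 Ci] Cmax]] := @Zorn_bigcup _ indep.
  split=> [m [X FX Xm]|m n [X FX Xm] [Y FY Yn]]; first exact: (FP _ FX).1.
  by have [XY|YX] := Ftot _ _ FX FY;
    [apply: (FP _ FY).2 => //; apply: XY|apply: (FP _ FX).2 => //; apply: YX].
have /choice[q qE] : forall m, exists p, y m != 0 -> p \in supp (y m).
  move=> m; have [->|/supp0[p pm]] := eqVneq (y m) 0; first by exists m.
  by exists p.
(* [phi] adds up the coordinates indexed by the [q m], [m] in [C]. On [y m] only the coordinate
   [q m] survives: another [q n] in [supp (y m)] would make [m] and [n] adjacent. So [m] lies in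
   [supp z]. *)
pose c p : R := (`[< exists2 m, C m & q m = p >])%:R.
have [phi phiE] := linear_of_linear (flin c).
have [z zE] := uh phi.
have Cz m : C m -> m \in supp z.
  move=> Cm; have ym := C0 _ Cm; rewrite sE; apply/eqP => /(hermitian_eq0 hh).
  rewrite -zE phiE (bigD1_seq (q m)) ?qE ?fset_uniq //= {1}/c asboolT;
    last by exists m.
  rewrite mulr1 big1_seq => [|p /andP[pq pm]].
    by rewrite addr0 => /eqP; rewrite (negPf (_ : f _ _ != 0)) // -suppE qE.
  rewrite /c asboolF ?mulr0 // => -[n Cn qn].
  have nm : nbr m n by exists p; rewrite // -qn sC qE // C0.
  by move: pq; rewrite -qn (Ci _ _ Cm Cn nm) eqxx.
(* The neighbours of [supp z]. By maximality of [C], each [n] with [y n != 0] is in [C] or adjacent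
   to it, hence in [A]. *)
pose A := \bigcup_(m <- supp z) \bigcup_(p <- supp (y m)) supp (y p).
have inA m n : m \in supp z -> nbr m n -> n \in A.
  move=> mz [p pm np]; apply/bigfcupP; exists m; rewrite ?mz //.
  by apply/bigfcupP; exists p; rewrite ?pm.
have yA n : y n != 0 -> n \in A.
  move=> yn; have [Cn|nCn] := pselect (C n).
    by apply: inA (nbrr _ yn); apply: Cz.
  have [[m Cm mn]|nn] := pselect (exists2 m, C m & nbr m n).
    by apply: inA mn; apply: Cz.
  case: (Cmax (C `|` [set n])%classic); first split=> [m|].
    + by left.
    + by move=> /(_ n (or_intror erefl)).
  split=> [m [/C0|->]|m m' [Cm|->] [Cm'|->] //] //; first exact: Ci.
  - by move=> mn; case: nn; exists m.
  - by move=> /nbrC mn; case: nn; exists m'.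
exists [seq (m, y m) | m <- A] => x.
rewrite big_map [LHS]decE; apply: big_fset_incl => [|m _].
  apply/fsubsetP => m; rewrite sE => mx; apply: yA; apply: contra_neq mx => ->.
  exact: herm0r hh _.
by rewrite sE negbK => /eqP ->; rewrite scale0r.
Qed.

End Finiteness.

(** * Units and divisibility in a valuation ring of a field *)

Section ValuationSubring.
Context (K : fieldType) (O : subringClosed K).
Hypothesis O_total : forall a, a \in O \/ a^-1 \in O.

Definition unit_of (a : K) := [&& a != 0, a \in O & a^-1 \in O].

Lemma unit_ofM a b : a \in O -> b \in O -> unit_of (a * b) -> unit_of a.
Proof.
rewrite /unit_of mulf_eq0 negb_or => aO bO /and3P[/andP[a0 b0] _ abO].
by rewrite a0 aO (_ : a^-1 = b * (a * b)^-1) ?rpredM //; field; rewrite a0 b0.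
Qed.

(** Locality of [O]: if [d / c] is integral, then [c] divides the unit [c + d = c * (1 + d / c)];
    [O_total] compares [a] with [b]. *)
Lemma unit_ofD a b : a \in O -> b \in O -> unit_of (a + b) ->
  unit_of a \/ unit_of b.
Proof.
have aux c d : c \in O -> d \in O -> unit_of (c + d) -> d / c \in O -> c != 0 ->
    unit_of c.
  move=> cO dO cdu dcO c0; apply: (@unit_ofM c (1 + d / c)) => //.
    by rewrite rpredD // rpred1.
  by rewrite mulrDr mulr1 mulrCA divff // mulr1.
move=> aO bO abu; have [a0|a0] := eqVneq a 0.
  by right; move: abu; rewrite a0 add0r.
have [b0|b0] := eqVneq b 0; first by left; move: abu; rewrite b0 addr0.
have [baO|] := O_total (b / a); first by left; apply: aux abu _ _.
by rewrite invf_div => abO; right; apply: (aux b a) => //; rewrite addrC.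
Qed.

Lemma unit_of_sum (I : eqType) (r : seq I) (F : I -> K) :
  (forall i, i \in r -> F i \in O) -> unit_of (\sum_(i <- r) F i) ->
  exists2 i, i \in r & unit_of (F i).
Proof.
elim: r => [|i r IHr] FO; first by rewrite big_nil /unit_of eqxx.
have FrO j : j \in r -> F j \in O by move=> jr; rewrite FO // inE jr orbT.
rewrite big_cons => /unit_ofD[]; first by rewrite FO ?mem_head.
- by rewrite big_seq rpred_sum.
- by exists i; rewrite ?mem_head.
- by case/(IHr FrO) => j jr Fj; exists j; rewrite // inE jr orbT.
Qed.

(** An entry of least valuation: by [O_total], divisibility over [O] is total. *)
Lemma dominant_term (I : eqType) (r : seq I) (a : I -> K) :
  (exists2 i, i \in r & a i != 0) ->
  exists i, [/\ i \in r, a i != 0 & forall j, j \in r -> a j / a i \in O].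
Proof.
elim: r => [|i r IHr] [k]; first by rewrite in_nil.
move=> kr ak; have [[k' kr' ak']|r0] := pselect (exists2 k, k \in r & a k != 0).
  have [|j [jr aj jO]] := IHr; first by exists k'.
  have [ijO|jiO] := O_total (a i / a j).
    exists j; rewrite inE jr orbT; split=> // l; rewrite inE => /predU1P[->|/jO]//.
  have [ai|ai] := eqVneq (a i) 0.
    exists j; rewrite inE jr orbT; split=> // l; rewrite inE => /predU1P[->|/jO]//.
    by rewrite ai mul0r rpred0.
  exists i; rewrite mem_head; split=> // l; rewrite inE => /predU1P[->|/jO lO].
    by rewrite divff // rpred1.
  have -> : a l / a i = a l / a j * (a i / a j)^-1 by field; rewrite ai aj.
  exact: rpredM.
have rz j : j \in r -> a j = 0.
  by move=> jr; apply/eqP/negPn/negP => aj; apply: r0; exists j.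
have eik : k = i.
  by move: kr; rewrite inE => /predU1P[//|/rz e]; rewrite e eqxx in ak.
exists i; rewrite mem_head -eik; split=> // j; rewrite inE => /predU1P[->|/rz->].
  by rewrite eik divff ?rpred1 // -eik.
by rewrite mul0r rpred0.
Qed.

End ValuationSubring.

(** * Orthogonal systems and projections over a field *)

Section OrthogonalSystems.
Context (K : fieldType) (sigma : {rmorphism K -> K}) (V : lmodType K).
Context (H : V -> V -> K).
Hypothesis hH : hermitian_form sigma H.

(** Indexing by [nat], with only the first [n] entries relevant, lets systems be truncated and
    extended without casts. *)
Definition orthogonal_system n (b : nat -> K) (z : nat -> V) :=
  forall i j, (i < n)%N -> (j < n)%N -> H (z i) (z j) = if i == j then b i else 0.

(** Stands in for spanning, see [complete_expand]. *)
Definition complete_system n (z : nat -> V) :=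
  forall v, (forall i, (i < n)%N -> H v (z i) = 0) -> v = 0.

Lemma hermNl x y : H (- x) y = - H x y.
Proof. by rewrite -scaleN1r (hermZl hH) mulN1r. Qed.

Lemma hermNr x y : H x (- y) = - H x y.
Proof. by rewrite -scaleN1r (hermZr hH) rmorphN1 mulrN1. Qed.

Definition herm_expand :=
  ((hermitianDl hH), (hermitianDr hH), (hermZl hH), (hermZr hH), hermNl, hermNr).

Definition orthogonal_part n (z : nat -> V) x :=
  x - \sum_(i < n) (H x (z i) / H (z i) (z i)) *: z i.

Section Projection.
Context (n : nat) (b : nat -> K) (z : nat -> V).
Hypothesis b0 : forall i, (i < n)%N -> b i != 0.
Hypothesis zb : orthogonal_system n b z.

Lemma orthogonal_part_orthogonal x j :
  (j < n)%N -> H (orthogonal_part n z x) (z j) = 0.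
Proof.
move=> jn; rewrite !herm_expand (herm_suml hH) (bigD1 (Ordinal jn)) //= big1 ?addr0.
  by rewrite (hermZl hH) divfK ?subrr // zb // eqxx b0.
move=> i; rewrite -val_eqE => ij; rewrite (hermZl hH).
by rewrite [H (z i) (z j)]zb // (negPf ij) mulr0.
Qed.

Lemma herm_orthogonal_part w x : (forall i, (i < n)%N -> H w (z i) = 0) ->
  H w (orthogonal_part n z x) = H w x.
Proof.
move=> wz; rewrite !herm_expand (herm_sumr hH) big1 ?subr0 // => i _.
by rewrite (hermZr hH) wz // mul0r.
Qed.

Lemma complete_expand x : complete_system n z ->
  x = \sum_(i < n) (H x (z i) / b i) *: z i.
Proof.
move=> zc; apply/eqP; rewrite -subr_eq0; apply/eqP.
have := zc _ (orthogonal_part_orthogonal x); rewrite /orthogonal_part => e.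
rewrite -[RHS]e; congr (_ - _); apply: eq_bigr => i _.
by rewrite zb // eqxx.
Qed.

(* The Gram matrix of the system, which is invertible, factors through the
   space of coordinates indexed by r. *)
Lemma orthogonal_system_size (r : seq (V * V)) :
  (forall x, x = \sum_(p <- r) H x p.2 *: p.1) -> (n <= size r)%N.
Proof.
move=> rE; pose t := nth (0, 0) r.
pose A := \matrix_(i < n, j < size r) H (z i) (t j).2.
pose B := \matrix_(j < size r, i < n) H (t j).1 (z i).
have AB : A *m B = diag_mx (\row_(i < n) b i).
  apply/matrixP => i k; rewrite !mxE -val_eqE /=.
  transitivity (H (z i) (z k)); last by rewrite zb //; case: eqP.
  rewrite [z i in RHS]rE (herm_suml hH) (big_nth (0, 0)) big_mkord.
  by apply: eq_bigr => j _; rewrite !mxE (hermZl hH).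
have : row_free (A *m B).
  rewrite AB row_free_unit unitmxE det_diag unitfE.
  by apply/prodf_neq0 => i _; rewrite mxE b0.
rewrite /row_free => /eqP <-.
by apply: leq_trans (mulmx_max_rank _ _) _.
Qed.
End Projection.
End OrthogonalSystems.

(** * Quasi-reflections of hermitian spaces *)

Section Reflections.
Context (K : fieldType) (sigma : {rmorphism K -> K}) (V : lmodType K).
Context (H : V -> V -> K).
Hypothesis hH : hermitian_form sigma H.
Hypothesis two_neq0 : (2 : K) != 0.

(** With [a = H x v], the map is [w - (H w v / a) *: v]. It preserves [H] because
    [a + sigma a = H v v], which also says that [x] and [x - v] have the same value. *)
Lemma quasi_reflection v x : H v v != 0 -> H x v + H v x = H v v ->
  exists s : V -> V, [/\ forall w w', H (s w) (s w') = H w w',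
    forall w, exists w', s w' = w, s x = x - v &
    forall w, H w v = 0 -> s w = w].
Proof.
move=> v0 xv; set a := H x v.
have sa : sigma a = H v x by rewrite [RHS](hermitianC hH).
have a0 : a != 0.
  by apply: contra_neq v0 => a0; rewrite -xv -sa -/a a0 rmorph0 addr0.
have sa0 : sigma a != 0 by rewrite fmorph_eq0.
have svv : H v v = a + sigma a by rewrite sa.
pose q c w := w - (H w v * c) *: v.
exists (q a^-1); split=> [w w'|w||w wv]; last by rewrite /q wv mul0r scale0r subr0.
- rewrite /q !(herm_expand hH) svv rmorphM -(hermitianC hH) fmorphV.
  by field; rewrite sa0 a0.
(* The inverse has the same shape, with [sigma a] in place of [a]. *)
- exists (q (sigma a)^-1 w); rewrite /q !(herm_expand hH) svv.
  rewrite -addrA -opprD -scalerDl [X in X *: v](_ : _ = 0) ?scale0r ?subr0 //.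
  by field; rewrite sa0 a0.
- by rewrite /q -/a divff // scale1r.
Qed.

Lemma isometry_moving x y : H x x = H y y -> H x x != 0 ->
  exists s : V -> V, [/\ forall w w', H (s w) (s w') = H w w',
    forall w, exists w', s w' = w, s x = y &
    forall w, H w x = 0 -> H w y = 0 -> s w = w].
Proof.
move=> xy x0.
have [v0|v0] := eqVneq (H (x - y) (x - y)) 0; last first.
  have [|s [sH ssurj sx sfix]] := @quasi_reflection (x - y) x v0.
    by rewrite !(herm_expand hH) -xy; ring.
  exists s; split=> // [|w wx wy]; first by rewrite sx opprB addrC subrK.
  by apply: sfix; rewrite !(herm_expand hH) wx wy subr0.
(* The values of [x - y] and [x + y] add up to [4 * H x x], so [x + y] is anisotropic. Its
   quasi-reflection takes [x] to [- y], and one along [y] then takes [- y] to [y]. *)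
have four_neq0 : (4 : K) != 0 by rewrite (natrM _ 2 2) mulf_neq0.
have [||s [sH ssurj sx sfix]] := @quasi_reflection (x + y) x.
- apply: contra_neq (mulf_neq0 four_neq0 x0) => v1.
  by move: (congr2 +%R v0 v1); rewrite !(herm_expand hH) -xy addr0 => <-; ring.
- by rewrite !(herm_expand hH) -xy; ring.
have s2 : sigma (- 2) = - 2 by rewrite rmorphN rmorph_nat.
have [||s' [s'H s'surj s'x s'fix]] := @quasi_reflection ((- 2) *: y) (- y).
- by rewrite !(herm_expand hH) -xy s2 !mulf_neq0 ?oppr_eq0.
- by rewrite !(herm_expand hH) -xy s2; ring.
exists (s' \o s); split=> [w w'|w||w wx wy] /=.
- by rewrite s'H.
- by have [w' <-] := s'surj w; have [w'' <-] := ssurj w'; exists w''.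
- by rewrite sx opprD addNKr s'x scaleNr opprK scaler_nat mulr2n addKr.
- rewrite sfix ?s'fix //; rewrite !(herm_expand hH).
    by rewrite wy mul0r.
  by rewrite wx wy addr0.
Qed.

End Reflections.

(** * Integral lattices over a valuation ring in which [2] is a unit *)

Section Lattice.
Context (K : fieldType) (O : subringClosed K) (sigma : {rmorphism K -> K}).
Hypothesis sigmaK : involutive sigma.
Hypothesis O_total : forall a, a \in O \/ a^-1 \in O.
Hypothesis O_sigma : forall a, a \in O -> sigma a \in O.
Hypothesis two_unit : unit_of O 2.
Hypothesis unramified : forall c : K, c != 0 ->
  exists g, sigma g = g /\ unit_of O (c / g).

Context (V : lmodType K) (H : V -> V -> K) (L : V -> Prop).
Hypothesis hH : hermitian_form sigma H.
Hypothesis L0 : L 0.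
Hypothesis LD : forall x y, L x -> L y -> L (x + y).
Hypothesis LZ : forall a x, a \in O -> L x -> L (a *: x).
Hypothesis LH : forall x y, L x -> L y -> H x y \in O.

Let two_neq0 : (2 : K) != 0. Proof. by case/and3P: two_unit. Qed.

Lemma lattice_sum I (r : seq I) (F : I -> V) :
  (forall i, L (F i)) -> L (\sum_(i <- r) F i).
Proof. by move=> FL; apply: (big_ind L) => // i _; apply: FL. Qed.

Section Splitting.
Context (n : nat) (b : nat -> K) (z : nat -> V).
Hypothesis b_unit : forall i, (i < n)%N -> unit_of O (b i).
Hypothesis zb : orthogonal_system H n b z.
Hypothesis zL : forall i, (i < n)%N -> L (z i).

(** The [b i] are units, so the projection has integral coefficients. *)
Lemma lattice_orthogonal_part x : L x -> L (orthogonal_part H n z x).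
Proof.
move=> xL; rewrite /orthogonal_part -sumrN; apply: LD => //.
apply: lattice_sum => i; rewrite -scaleNr; apply: LZ (zL _) => //.
rewrite rpredN zb // eqxx rpredM ?LH //; first exact: zL.
by case/and3P: (b_unit (ltn_ord i)).
Qed.
End Splitting.

(** Scale [y] to [w] with [H x w = 1]. The value of [x + w] minus those of [x] and [w] is then [2],
    so by locality one of the three is a unit. *)
Lemma lattice_unit_value x y : L x -> L y -> unit_of O (H x y) ->
  exists c d, [/\ c \in O, d \in O &
    unit_of O (H (c *: x + d *: y) (c *: x + d *: y))].
Proof.
move=> xL yL /and3P[xy0 xyO xyO'].
have sO1 : (1 : K) \in O by exact: rpred1.
have [xu|xnu] := pselect (unit_of O (H x x)).
  by exists 1, 0; rewrite rpred0 scale1r scale0r addr0.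
set e := sigma (H x y)^-1; set w := e *: y.
have eO : e \in O by apply: O_sigma.
have wL : L w by exact: LZ.
have wE : w = e *: y by [].
have xw : H x w = 1 by rewrite (hermZr hH) /e sigmaK divff.
have wx : H w x = 1 by rewrite (hermitianC hH) xw rmorph1.
clearbody w.
have [wu|wnu] := pselect (unit_of O (H w w)).
  by exists 0, e; rewrite rpred0 scale0r add0r -wE.
exists 1, e; split=> //; rewrite scale1r -wE; apply/negPn/negP => nu.
have nuN a : unit_of O (- a) -> unit_of O a.
  by rewrite /unit_of oppr_eq0 invrN !rpredN.
have xwL : L (x + w) by exact: LD.
have u : unit_of O (H (x + w) (x + w) + (- H x x - H w w)).
  by rewrite !(herm_expand hH) xw wx (_ : _ + _ = 2) //; ring.
have xxO : - H x x \in O by rewrite rpredN LH.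
have wwO : - H w w \in O by rewrite rpredN LH.
have [|u'] := unit_ofD O_total (LH xwL xwL) (rpredD xxO wwO) u.
  by rewrite (negPf nu).
by have [/nuN|/nuN] := unit_ofD O_total xxO wwO u'.
Qed.

Lemma orthogonal_system_rcons n b z w :
  (forall i, (i < n)%N -> H w (z i) = 0) -> orthogonal_system H n b z ->
  orthogonal_system H n.+1 (fun i => if i == n then H w w else b i)
    (fun i => if i == n then w else z i).
Proof.
move=> wz zb i j; rewrite !ltnS => le_i le_j.
have [ei|ni] := eqVneq i n; have [ej|nj] := eqVneq j n;
  rewrite ?ei ?ej ?eqxx //.
- by rewrite wz ?ltn_neqAle ?nj // eq_sym (negPf nj).
- by rewrite (negPf ni) (hermitian_eq0 hH) // wz // ltn_neqAle ni.
- by rewrite zb // ltn_neqAle ?ni ?nj.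
Qed.

(** Take a unit-valued orthogonal system in [L] of maximal length. A nonzero [v] orthogonal to it
    would yield a unit pairing between projected lattice vectors, hence one more vector by
    [lattice_unit_value]. *)
Lemma exists_orthogonal_basis (r : seq (V * V)) :
  (forall p, p \in r -> L p.1 /\ L p.2) ->
  (forall x, x = \sum_(p <- r) H x p.2 *: p.1) ->
  exists n b z, [/\ forall i, (i < n)%N -> unit_of O (b i),
    orthogonal_system H n b z, forall i, (i < n)%N -> L (z i) &
    complete_system H n z].
Proof.
move=> rL rE.
pose good n := exists b z, [/\ forall i, (i < n)%N -> unit_of O (b i),
    orthogonal_system H n b z & forall i, (i < n)%N -> L (z i)].
have good0 : exists n, `[< good n >].
  by exists 0; apply/asboolP; exists (fun=> 0), (fun=> 0).
have unit0 a : unit_of O a -> a != 0 by case/and3P.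
have good_size n : `[< good n >] -> (n <= size r)%N.
  move=> /asboolP[b [z [bu zb _]]].
  by apply: (orthogonal_system_size hH _ zb rE) => i /bu/unit0.
case: (ex_maxnP good0 good_size) => n /asboolP[b [z [bu zb zL]]] nmax.
exists n, b, z; split=> // v vz.
have b0 i : (i < n)%N -> b i != 0 by move=> /bu/unit0.
pose pr := orthogonal_part H n z.
have prz x i : (i < n)%N -> H (pr x) (z i) = 0.
  exact: (orthogonal_part_orthogonal hH b0 zb).
have prL x : L x -> L (pr x) by apply: lattice_orthogonal_part bu zb zL _.
have nounit w : L w -> (forall i, (i < n)%N -> H w (z i) = 0) ->
    ~ unit_of O (H w w).
  move=> wL wz wu; have : good n.+1.
    exists (fun i => if i == n then H w w else b i).
    exists (fun i => if i == n then w else z i).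
    split; [|exact: orthogonal_system_rcons|] => i; case: eqVneq => // ni;
      rewrite ltnS => le_i; [apply: bu|apply: zL]; by rewrite ltn_neqAle ni.
  by move=> /asboolP/nmax; rewrite ltnn.
have [[p0 p0r p00]|all0] := pselect (exists2 p, p \in r & H v p.2 != 0); last first.
  rewrite [v]rE big1_seq // => p /= pr0.
  have [->|p0] := eqVneq (H v p.2) 0; first by rewrite scale0r.
  by case: all0; exists p.
have [|p [pr0 vp vO]] := @dominant_term _ _ O_total _ r (fun p => H v p.2).
  by exists p0.
have [p1L p2L] := rL p pr0.
have prpr x y : H (pr x) (pr y) = H x (pr y).
  rewrite (hermitianC hH x) (hermitianC hH (pr x)).
  by rewrite (herm_orthogonal_part hH x (prz y)).
have vpE : H v p.2 = \sum_(q <- r) H v q.2 * H (pr q.1) (pr p.2).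
  rewrite -[LHS](herm_orthogonal_part hH _ vz) [v in LHS]rE (herm_suml hH).
  by apply: eq_bigr => q _; rewrite (hermZl hH) prpr.
(* Dividing by the dominant coefficient [H v p.2] writes [1] as a sum of integral terms; some term,
   and with it some [H (pr q.1) (pr p.2)], is a unit. *)
have e : \sum_(q <- r) H v q.2 / H v p.2 * H (pr q.1) (pr p.2) = 1.
  apply: (mulIf vp); rewrite mul1r [RHS]vpE mulr_suml.
  by apply: eq_bigr => q _; rewrite mulrAC divfK.
have [||q qr /= qu] := @unit_of_sum _ _ O_total _ r
    (fun q => H v q.2 / H v p.2 * H (pr q.1) (pr p.2)).
- by move=> q qr; rewrite rpredM ?vO // LH //; apply: prL; case: (rL _ qr).
- by rewrite e /unit_of oner_eq0 invr1 rpred1.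
have qL : L (pr q.1) by apply: prL; case: (rL _ qr).
have [|c [d [cO dO u]]] := @lattice_unit_value (pr q.1) (pr p.2) qL (prL _ p2L).
  by move: qu; rewrite mulrC; apply: unit_ofM; rewrite ?vO // LH //; exact: prL.
case: (nounit _ _ _ u) => [|i lt_i].
  by apply: LD; apply: LZ => //; apply: prL.
by rewrite (hermitianDl hH) !(hermZl hH) !prz // !mulr0 addr0.
Qed.

(** * Descent of orthogonal bases to the lattice *)

Section Descent.
Context (n : nat) (be : nat -> K) (e : nat -> V).
Hypothesis be_unit : forall i, (i < n)%N -> unit_of O (be i).
Hypothesis e_orth : orthogonal_system H n be e.
Hypothesis eL : forall i, (i < n)%N -> L (e i).
Hypothesis e_complete : complete_system H n e.

(* Write x = g x0 with sigma g = g and x0 in L primitive, and choose y in L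
   with H x0 y = 1. If g is not integral, then p = 1 / g is in the maximal
   ideal and H x0 x0 = b p^2 for b = H x x. The integral vector w below is the
   second point at which the quadric H w w = b of the plane spanned by x0 and y
   meets the line through x = p^-1 x0 of direction p^-1 x0 + y. *)
Lemma lattice_represents k (b : nat -> K) (z : nat -> V) x :
  (forall i, (i < k)%N -> unit_of O (b i)) -> orthogonal_system H k b z ->
  (forall i, (i < k)%N -> L (z i)) -> (forall i, (i < k)%N -> H x (z i) = 0) ->
  unit_of O (H x x) ->
  exists w, [/\ L w, forall i, (i < k)%N -> H w (z i) = 0 & H w w = H x x].
Proof.
move=> bu zb zL xz xu.
have be0 i : (i < n)%N -> be i != 0 by move=> /be_unit/and3P[].
have b0 i : (i < k)%N -> b i != 0 by move=> /bu/and3P[].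
have [|j [jn xj xjO]] := @dominant_term _ _ O_total _ (iota 0 n) (fun i => H x (e i)).
  have [//|all0] := pselect (exists2 i, i \in iota 0 n & H x (e i) != 0).
  have x0 : x = 0.
    apply: e_complete => i lt_i; apply/eqP/negPn/negP => xi.
    by apply: all0; exists i; rewrite // mem_iota.
  by case/and3P: xu; rewrite x0 (herm0l hH) eqxx.
rewrite mem_iota /= in jn.
(* [g] has the valuation of the dominant pairing [H x (e j)], so [g^-1 *: x] has integral pairings
   with the [e i], that with [e j] being a unit. *)
have [g [sg gu]] := unramified xj.
have g0 : g != 0 by case/and3P: gu; rewrite mulf_eq0 invr_eq0 negb_or => /andP[].
have sgV : sigma g^-1 = g^-1 by rewrite fmorphV sg.
have [x0 x0E] : exists x0, x = g *: x0.
  by exists (g^-1 *: x); rewrite scalerA divff ?scale1r.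
have x0L : L x0.
  rewrite (complete_expand hH be0 e_orth x0 e_complete).
  have xO i : (i < n)%N -> H x0 (e i) \in O.
    move=> lt_i; have := xjO i; rewrite mem_iota => /(_ lt_i) iO.
    rewrite (_ : H x0 (e i) = H x (e i) / H x (e j) * (H x (e j) / g)).
      by rewrite rpredM //; case/and3P: gu.
    have -> : H x0 (e i) = H x (e i) / g by rewrite x0E (hermZl hH) mulrC mulKf.
    by field; rewrite g0 xj.
  apply: lattice_sum => i; apply: LZ (eL _) => //.
  by rewrite rpredM ?xO //; case/and3P: (be_unit (ltn_ord i)).
have [gO|gO] := boolP (g \in O).
  by exists x; split=> //; rewrite x0E; apply: LZ.
have x0z i : (i < k)%N -> H x0 (z i) = 0.
  by move=> /xz/eqP; rewrite x0E (hermZl hH) mulf_eq0 (negPf g0) => /eqP.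
have [y [yL yz x0y]] : exists y,
    [/\ L y, forall i, (i < k)%N -> H y (z i) = 0 & H x0 y = 1].
  (* Projecting [e j] away from the [z i] keeps its pairing with [x0], which is the unit
     [H x (e j) / g]; the scalar normalizes it to [1]. *)
  exists (sigma (g / H x (e j)) *: orthogonal_part H k z (e j)); split.
  - apply: LZ; last exact: lattice_orthogonal_part bu zb zL _ (eL jn).
    by rewrite O_sigma // -invf_div; case/and3P: gu.
  - move=> i lt_i.
    by rewrite (hermZl hH) (orthogonal_part_orthogonal hH b0 zb) // mulr0.
  - rewrite (hermZr hH) sigmaK (herm_orthogonal_part hH _ x0z) x0E (hermZl hH).
    move: xj; rewrite x0E (hermZl hH) mulf_eq0 negb_or => /andP[_ x0j].
    by field; rewrite x0j g0.
have yx0 : H y x0 = 1 by rewrite (hermitianC hH) x0y rmorph1.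
set p := g^-1; have pO : p \in O by case: (O_total g); rewrite // (negPf gO).
set d := H y y; have dO : d \in O by exact: LH.
set c := H x x; have cO : c \in O by case/and3P: xu.
have x0x0 : H x0 x0 = c * p ^+ 2.
  by rewrite /c x0E (hermitianZ hH) sg /p; field.
have sc : sigma c = c by rewrite -(hermitianC hH).
have sd : sigma d = d by rewrite -(hermitianC hH).
(* [p] times the value [c + d + 2 / p] of the direction [p^-1 *: x0 + y]; it is a unit because [2]
   is one and [p] is not. *)
pose D := 2 + p * (c + d).
have twoO : 2 \in O by case/and3P: two_unit.
have /and3P[D0 DO DO'] : unit_of O D.
  have pcdO : p * (c + d) \in O by rewrite !(rpredM, rpredD).
  have DO : D \in O by rewrite rpredD.
  have NO : - (p * (c + d)) \in O by rewrite rpredN.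
  have [||pu] := unit_ofD O_total DO NO; rewrite ?addrK //.
  have /and3P[_ _] : unit_of O p.
    apply: (@unit_ofM _ _ p (- (c + d))); rewrite ?rpredN ?rpredD //.
    by rewrite mulrN.
  by rewrite invrK (negPf gO).
have sp : sigma p = p by [].
have sD : sigma D = D by rewrite rmorphD rmorph_nat rmorphM rmorphD sp sc sd.
have dE : H y y = d by [].
clearbody p d c.
exists (((d - c) / D) *: x0 + (- (2 + 2 * p * c) / D) *: y); split.
- apply: LD; apply: LZ => //; rewrite rpredM //; first by rewrite rpredB.
  by rewrite rpredN rpredD // !rpredM.
- by move=> i lt_i; rewrite (hermitianDl hH) !(hermZl hH) x0z ?yz // !mulr0 addr0.
rewrite !(herm_expand hH) x0x0 x0y yx0 dE.
have -> : sigma ((d - c) / D) = (d - c) / D.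
  by rewrite fmorph_div rmorphB sd sc sD.
have -> : sigma (- (2 + 2 * p * c) / D) = - (2 + 2 * p * c) / D.
  by rewrite fmorph_div rmorphN rmorphD !rmorphM rmorph_nat sp sc sD.
by rewrite /D; field.
Qed.

(** Induction on the number [k] of vectors already in [L]. The earlier ones are orthogonal to both
    [z k] and its replacement, so the isometry fixes them; its surjectivity preserves
    completeness. *)
Lemma orthogonal_basis_descent m (b : nat -> K) (w : nat -> V) :
  (forall i, (i < m)%N -> unit_of O (b i)) -> orthogonal_system H m b w ->
  complete_system H m w ->
  exists z, [/\ orthogonal_system H m b z, complete_system H m z &
    forall i, (i < m)%N -> L (z i)].
Proof.
move=> bu wb wc.
suff /(_ m) [z [? ? zL]] : forall k, exists z, [/\ orthogonal_system H m b z,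
    complete_system H m z & forall i, (i < k)%N -> (i < m)%N -> L (z i)].
  by exists z; split=> // i lt_i; apply: zL.
elim=> [|k [z [zb zc zL]]]; first by exists w.
have [le_mk|lt_km] := leqP m k.
  by exists z; split=> // i ? ?; apply: zL => //; apply: leq_trans le_mk.
have zbk : orthogonal_system H k b z.
  by move=> i j lt_i lt_j; apply: zb; apply: ltn_trans lt_km.
have ltm i : (i < k)%N -> (i < m)%N by move=> lt_i; apply: ltn_trans lt_km.
have [||i lt_i||x [xL xz xx]] := @lattice_represents k b z (z k) _ zbk.
- by move=> i /ltm/bu.
- by move=> i lt_i; apply: zL => //; apply: ltm.
- by rewrite zb ?lt_km ?ltm ?(gtn_eqF lt_i).
- by rewrite zb // eqxx bu.
have [|s [sH ssurj sx sfix]] := isometry_moving hH two_neq0 (esym xx).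
  by rewrite zb // eqxx; case/and3P: (bu _ lt_km).
exists (s \o z); split=> [i j lt_i lt_j|v vz|i lt_ik lt_im] /=.
- by rewrite sH zb.
- have [v' v'E] := ssurj v; rewrite -v'E in vz *.
  have -> : v' = 0 by apply: zc => i /vz; rewrite sH.
  by rewrite sfix // (herm0l hH).
move: lt_ik; rewrite ltnS leq_eqVlt => /predU1P[->|lt_ik]; first by rewrite sx.
rewrite sfix; [exact: zL|by rewrite zb ?(ltn_eqF lt_ik)|].
by apply: (hermitian_eq0 hH); apply: xz.
Qed.

End Descent.

End Lattice.

(** The isometry takes [z i] to [z' i]. Defining it by the coefficients [h x (z i) * d i] makes
    linearity immediate, and equal Gram matrices give [h' (u x) (z' j) = h x (z j)]. *)
Lemma isometric_of_expansions (R : nzRingType) (s : R -> R)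
    (M M' : lmodType R) (h : M -> M -> R) (h' : M' -> M' -> R) n
    (d : nat -> R) (z : nat -> M) (z' : nat -> M') :
  hermitian_form s h -> hermitian_form s h' ->
  (forall i j, (i < n)%N -> (j < n)%N -> h (z i) (z j) = h' (z' i) (z' j)) ->
  (forall x, x = \sum_(i < n) (h x (z i) * d i) *: z i) ->
  (forall x, x = \sum_(i < n) (h' x (z' i) * d i) *: z' i) ->
  isometric h h'.
Proof.
move=> hh hh' zz' expand expand'.
have [u uE] : exists u : {linear M -> M'},
    forall x, u x = \sum_(i < n) (h x (z i) * d i) *: z' i.
  apply: linear_of_linear => a x y; rewrite scaler_sumr -big_split.
  apply: eq_bigr => i _; rewrite (hermitianDl hh) (hermZl hh) mulrDl scalerDl.
  by rewrite scalerA mulrA.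
pose v x := \sum_(i < n) (h' x (z' i) * d i) *: z i.
have uz x j : (j < n)%N -> h' (u x) (z' j) = h x (z j).
  move=> lt_j; rewrite uE (herm_suml hh') [x in RHS]expand (herm_suml hh).
  by apply: eq_bigr => i _; rewrite (hermZl hh) (hermZl hh') zz'.
have vz x j : (j < n)%N -> h (v x) (z j) = h' x (z' j).
  move=> lt_j; rewrite (herm_suml hh) [x in RHS]expand' (herm_suml hh').
  by apply: eq_bigr => i _; rewrite (hermZl hh) (hermZl hh') zz'.
exists u; split=> [|x y].
  exists v => x; [rewrite [RHS]expand|rewrite [RHS]expand' uE].
    by apply: eq_bigr => i _; rewrite uz.
  by apply: eq_bigr => i _; rewrite vz.
rewrite [u y]uE [y in RHS]expand (herm_sumr hh) (herm_sumr hh').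
by apply: eq_bigr => i _; rewrite (hermZr hh) (hermZr hh') uz.
Qed.

(** * Functoriality of scalar extension *)

Section TensorMap.
Context (R T : nzRingType) (i : {rmorphism R -> T}).

Lemma tensor_ind (M : lmodType R) (P : tensor i M -> Prop) :
  P 0 -> (forall t u, P t -> P u -> P (t + u)) ->
  (forall a x, P (tens i a x)) -> forall t, P t.
Proof. by move=> P0 PD Pt t; rewrite [t]tensorE; apply: big_ind => // p _. Qed.

Lemma tensor_map (M M' : lmodType R) (u : {linear M -> M'}) :
  exists f : {linear tensor i M -> tensor i M'},
    forall a x, f (tens i a x) = tens i a (u x).
Proof.
pose F a x := tens i a (u x) : tensor i M'.
have FDl a b x : F (a + b) x = F a x + F b x by exact: tensDl.
have FDr a x y : F a (x + y) = F a x + F a y by rewrite /F linearD tensDr.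
have FZ a c x : F a (c *: x) = F (a * i c) x by rewrite /F linearZ tensZ.
pose lF : tensor i M -> tensor i M' := tensor_lift F.
have FE a x : lF (tens i a x) = tens i a (u x).
  exact: (tensor_lift_tens FDl FDr FZ).
have FD t t' : lF (t + t') = lF t + lF t'.
  by apply: tensor_liftD.
have F0 : lF 0 = 0.
  by apply: (addrI (lF 0)); rewrite -FD !addr0.
have Fl : linear lF.
  move=> a t t'; rewrite FD; congr (_ + _).
  elim/tensor_ind: t => [|t u' IHt IHu|b x].
  - by rewrite scaler0 F0 scaler0.
  - by rewrite scalerDr !FD IHt IHu scalerDr.
  - by rewrite scale_tens !FE scale_tens.
have [f fE] := linear_of_linear Fl.
by exists f => a x; rewrite fE FE.
Qed.

End TensorMap.

(** * Inverses and units in the valuation ring of [nu] *)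

Section ValuationRing.
Context (K : fieldType) (G : orderedGroupType) (nu : valuation K G).

Lemma valuationV a : a != 0 -> nu a^-1 = - nu a.
Proof.
move=> a0; apply: (addrI (nu a)).
by rewrite -valuationM ?invr_eq0 // divff // valuation1 subrr.
Qed.

Lemma valring_total a : a \in valring_pred nu \/ a^-1 \in valring_pred nu.
Proof.
rewrite !in_valring invr_eq0; have [->|a0] := eqVneq a 0; first by left.
rewrite valuationV //=; have /orP[|a_le0] := ordgroup_total 0 (nu a); first by left.
by right; have := ordgroup_leD2r (- nu a) _ _ a_le0; rewrite subrr add0r.
Qed.

Lemma unit_of_valring a : a != 0 -> nu a = 0 ->
  unit_of (valring_pred nu) a.
Proof.
move=> a0 na; rewrite /unit_of !in_valring valuationV // na oppr0.
by rewrite Order.POrderTheory.lexx !orbT a0.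
Qed.

End ValuationRing.

(** * The lattice of a hermitian space in its scalar extension *)

Section Extension.
Context (K : fieldType) (G : orderedGroupType) (nu : valuation K G).
Context (sigma : {rmorphism K -> K}).
Hypothesis sigmaK : involutive sigma.
Hypothesis nu_sigma : forall a, nu (sigma a) = nu a.
Local Notation S := (valring nu).
Local Notation i := (val : {rmorphism valring nu -> K}).

Let sigmaM a b : sigma (a * b) = sigma b * sigma a.
Proof. by rewrite rmorphM mulrC. Qed.

Let sigma_i c : sigma (i c) = i (valring_map nu_sigma c).
Proof. by []. Qed.

Section Space.
Context (M : lmodType S) (h : M -> M -> S).
Hypothesis hM : hermitian_space (valring_map nu_sigma) h.
Hypothesis uh : unimodular h.
Let hh := hspace_form hM.
Local Notation V := (tensor i M).
Local Notation H := (base_form (i := i) (M := M) sigma h).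

Definition embed (x : M) : V := tens i 1 x.

Definition lattice (v : V) : Prop := exists x, v = embed x.

Lemma extension_hermitian : hermitian_form sigma H.
Proof. exact: base_form_hermitian (rmorphD sigma) sigmaM sigmaK sigma_i hh. Qed.

Let hH := extension_hermitian.

Lemma extension_tens a x b y :
  H (tens i a x) (tens i b y) = a * val (h x y) * sigma b.
Proof. exact: base_form_tens (rmorphD sigma) sigmaM sigma_i hh _ _ _ _. Qed.

Lemma extension_embed x y : H (embed x) (embed y) = val (h x y).
Proof. by rewrite extension_tens rmorph1 mul1r mulr1. Qed.

Lemma embedD x y : embed (x + y) = embed x + embed y.
Proof. exact: tensDr. Qed.

Lemma embedZ a x : embed (a *: x) = val a *: embed x.
Proof. by rewrite /embed tensZ scale_tens mulr1 mul1r. Qed.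

Lemma embed0 : embed 0 = 0.
Proof. by rewrite -(scale0r 0) embedZ scale0r. Qed.

Lemma embed_sum I (r : seq I) (F : I -> M) :
  embed (\sum_(k <- r) F k) = \sum_(k <- r) embed (F k).
Proof. by apply: (big_morph embed embedD embed0). Qed.

Lemma extension_expand (r : seq (M * M)) :
  (forall x, x = \sum_(p <- r) h x p.2 *: p.1) ->
  forall v, v = \sum_(p <- [seq (embed p.1, embed p.2) | p <- r]) H v p.2 *: p.1.
Proof.
move=> rE; elim/tensor_ind => [|t u IHt IHu|a x].
- by rewrite big1 // => p _; rewrite (herm0l hH) scale0r.
- rewrite {1}IHt {1}IHu -big_split; apply: eq_bigr => p _ /=.
  by rewrite (hermitianDl hH) scalerDl.
- have -> : tens i a x = a *: embed x by rewrite scale_tens mulr1.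
  rewrite {1}(rE x) embed_sum scaler_sumr big_map; apply: eq_bigr => p _ /=.
  by rewrite (hermZl hH) embedZ scalerA extension_embed.
Qed.

(** By unimodularity an equality in [M] can be tested on pairings with every [y], and these are
    computed after scalar extension. *)
Lemma embed_expand n (b : nat -> K) (d : nat -> S) (z : nat -> M) :
  (forall k, (k < n)%N -> b k != 0) ->
  (forall k, (k < n)%N -> val (d k) = (b k)^-1) ->
  orthogonal_system H n b (embed \o z) -> complete_system H n (embed \o z) ->
  forall x, x = \sum_(k < n) (h x (z k) * d k) *: z k.
Proof.
move=> b0 dE zb zc x; apply: uh.1 => y; apply: val_inj.
rewrite -!extension_embed [embed x](complete_expand hH b0 zb _ zc).
congr (H _ _); rewrite embed_sum; apply: eq_bigr => k _.
by rewrite embedZ rmorphM /= dE // extension_embed.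
Qed.

End Space.

Section Descent.
Context (M : lmodType S) (h : M -> M -> S).
Hypothesis hM : hermitian_space (valring_map nu_sigma) h.
Hypothesis uh : unimodular h.
Hypothesis nu2 : (2 : K) != 0 /\ nu 2 = 0.
Local Notation V := (tensor i M).
Local Notation H := (base_form (i := i) (M := M) sigma h).
Local Notation O := (valring_pred nu : subringClosed K).
Let hH : hermitian_form sigma H := extension_hermitian hM.

Let O_sigma a : a \in O -> sigma a \in O.
Proof. by rewrite !in_valring nu_sigma fmorph_eq0. Qed.

Let two_unit : unit_of O 2.
Proof. by case: nu2 => *; apply: unit_of_valring. Qed.

Let L0 : lattice (0 : V).
Proof. by exists 0; rewrite embed0. Qed.

Let LD (x y : V) : lattice x -> lattice y -> lattice (x + y).
Proof. by move=> [a ->] [c ->]; exists (a + c); rewrite embedD. Qed.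

Let LZ a (x : V) : a \in O -> lattice x -> lattice (a *: x).
Proof. by move=> aO [c ->]; exists ((exist _ a aO : S) *: c); rewrite embedZ. Qed.

Let LH (x y : V) : lattice x -> lattice y -> H x y \in O.
Proof. by move=> [a ->] [c ->]; rewrite (extension_embed hM); exact: valP. Qed.

Lemma lattice_orthogonal_basis : exists n b (z : nat -> V),
  [/\ forall k, (k < n)%N -> unit_of O (b k), orthogonal_system H n b z,
      forall k, (k < n)%N -> lattice (z k) & complete_system H n z].
Proof.
have [r rE] := unimodular_finite_dual_basis hM uh.
apply: (exists_orthogonal_basis sigmaK (@valring_total _ _ nu) O_sigma two_unit
          hH L0 LD LZ LH _ (extension_expand hM rE)).
by move=> _ /mapP[p _ ->]; split; [exists p.1|exists p.2].
Qed.

Lemma lattice_orthogonal_basis_descent :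
  (forall c : K, c != 0 -> exists g, sigma g = g /\ unit_of O (c / g)) ->
  forall n (b : nat -> K) (w : nat -> V),
  (forall k, (k < n)%N -> unit_of O (b k)) -> orthogonal_system H n b w ->
  complete_system H n w ->
  exists z, [/\ orthogonal_system H n b z, complete_system H n z &
    forall k, (k < n)%N -> lattice (z k)].
Proof.
move=> unram n b w bu wb wc.
have [m [be [e [beu eb eL ec]]]] := lattice_orthogonal_basis.
exact: (orthogonal_basis_descent sigmaK (@valring_total _ _ nu) O_sigma two_unit
  unram hH L0 LD LZ LH beu eb eL ec bu wb wc).
Qed.

End Descent.
End Extension.

(** * Transport of isometries and the equivalence *)

Lemma isometric_extension (R T : nzRingType) (i : {rmorphism R -> T})
    (M M' : lmodType R) (s : R -> R) (tau : T -> T)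
    (h : M -> M -> R) (h' : M' -> M' -> R) :
  (forall a b, tau (a + b) = tau a + tau b) ->
  (forall a b, tau (a * b) = tau b * tau a) -> involutive tau ->
  (forall c, tau (i c) = i (s c)) ->
  hermitian_form s h -> hermitian_form s h' ->
  isometric h h' -> isometric_over i tau h h'.
Proof.
move=> tauD tauM tauK taui hh hh' [u [[v uK vK] uh]].
(* The inverse is given as a mere function; linearity is needed to extend it to tensors. *)
have [v' v'E] : exists v' : {linear M' -> M}, v' =1 v.
  apply: linear_of_linear => a x y.
  by apply: (can_inj uK); rewrite linearP !vK.
have [f fE] := tensor_map i u; have [g gE] := tensor_map i v'.
have hH := base_form_hermitian tauD tauM tauK taui hh.
have hH' := base_form_hermitian tauD tauM tauK taui hh'.
exists f; split=> [|].
  exists g; elim/tensor_ind => [|t t' et et'|a x]; rewrite ?linear0 //.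
  - by rewrite !linearD et et'.
  - by rewrite fE gE v'E uK.
  - by rewrite !linearD et et'.
  - by rewrite gE fE v'E vK.
elim/tensor_ind => [t|t1 t2 e1 e2 t|a x].
- by rewrite linear0 (herm0l hH) (herm0l hH').
- by rewrite linearD (hermitianDl hH) (hermitianDl hH') e1 e2.
elim/tensor_ind => [|t1 t2 e1 e2|b y].
- by rewrite linear0 (herm0r hH) (herm0r hH').
- by rewrite linearD (hermitianDr hH) (hermitianDr hH') e1 e2.
rewrite !fE (base_form_tens tauD tauM taui hh).
by rewrite (base_form_tens tauD tauM taui hh') uh.
Qed.

Lemma orthogonal_system_isometry (K : fieldType) (V V' : lmodType K)
    (H : V -> V -> K) (H' : V' -> V' -> K) (u : {linear V -> V'}) v n b z :
  cancel u v -> cancel v u -> (forall x y, H' (u x) (u y) = H x y) ->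
  orthogonal_system H' n b z -> complete_system H' n z ->
  orthogonal_system H n b (v \o z) /\ complete_system H n (v \o z).
Proof.
move=> uK vK uH zb zc; split=> [i j lt_i lt_j|x xz] /=; first by rewrite -uH !vK zb.
apply: (can_inj uK); rewrite linear0; apply: zc => i /xz /=.
by rewrite -uH vK.
Qed.

Lemma orthogonal_system_eq (K : fieldType) (V : lmodType K) (H : V -> V -> K)
    n b z z' : (forall i, (i < n)%N -> z i = z' i) ->
  orthogonal_system H n b z -> complete_system H n z ->
  orthogonal_system H n b z' /\ complete_system H n z'.
Proof.
move=> zz' zb zc; split=> [i j lt_i lt_j|x xz]; first by rewrite -!zz' // zb.
by apply: zc => i lt_i; rewrite zz' // xz.
Qed.

Theorem theorem1 (F K : fieldType) (iota : {rmorphism F -> K})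
    (sigma : {rmorphism K -> K}) (sigmaK : involutive sigma)
    (fixed_sigma : forall a : K, sigma a = a <-> exists c : F, a = iota c)
    (Gamma : orderedGroupType) (nu : valuation K Gamma)
    (nu_surj : forall g : Gamma, exists a : K, a != 0 /\ nu a = g)
    (nu_sigma : forall a : K, nu (sigma a) = nu a)
    (nu2 : (2 : K) != 0 /\ nu 2 = 0)
    (nu_unramified : forall g : Gamma, exists c : F, c != 0 /\ nu (iota c) = g)
    (M M' : lmodType (valring nu))
    (h : M -> M -> valring nu) (h' : M' -> M' -> valring nu)
    (hM : hermitian_space (valring_map nu_sigma) h)
    (hM' : hermitian_space (valring_map nu_sigma) h')
    (uh : unimodular h) (uh' : unimodular h') :
  isometric_over (val : {rmorphism valring nu -> K}) sigma h h' <->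
  isometric h h'.
Proof.
have hh := hspace_form hM; have hh' := hspace_form hM'.
split; last first.
  apply: isometric_extension hh hh' => // [|a b]; first exact: rmorphD.
  by rewrite rmorphM mulrC.
move=> [u [[v uK vK] uH]].
(* The scalar [g] is the image of an element of [F] with the valuation of [c]. *)
have unram (c : K) : c != 0 ->
    exists g, sigma g = g /\ unit_of (valring_pred nu) (c / g).
  move=> c0; have [g [g0 ng]] := nu_unramified (nu c).
  exists (iota g); split; first by apply/fixed_sigma; exists g.
  have ig0 : iota g != 0 by rewrite fmorph_eq0.
  apply: unit_of_valring; first by rewrite mulf_neq0 ?invr_eq0.
  by rewrite valuationM ?invr_eq0 // valuationV // ng subrr.
have [n [b [z' [bu zb' zL' zc']]]] :=
  lattice_orthogonal_basis sigmaK hM' uh' nu2.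
(* The inverse isometry carries the basis [z'] into the extension of [M]; the values [b] survive
   this and the descent. *)
have [wb wc] := orthogonal_system_isometry uK vK uH zb' zc'.
have [z [zb zc zL]] :=
  lattice_orthogonal_basis_descent sigmaK hM uh nu2 unram bu wb wc.
have lift (N : lmodType (valring nu)) (t : nat -> tensor _ N) :
    (forall k, (k < n)%N -> lattice (t k)) ->
    exists x : nat -> N, forall k, (k < n)%N -> t k = embed (x k).
  move=> tL; suff /choice[x tE] : forall k, exists x, (k < n)%N -> t k = embed x.
    by exists x.
  move=> k; case: (ltnP k n) => [/tL[x]|_]; [by exists x|by exists 0].
have [x xE] := lift _ _ zL; have [x' x'E] := lift _ _ zL'.
have [xb xc] := orthogonal_system_eq xE zb zc.
have [xb' xc'] := orthogonal_system_eq x'E zb' zc'.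
have b0 k : (k < n)%N -> b k != 0 by move=> /bu/and3P[].
(* The units [b k] have inverses in the valuation ring; beyond [n] the value [0] is a filler. *)
have /choice[d dE] : forall k, exists d : valring nu, (k < n)%N -> val d = (b k)^-1.
  move=> k; case: (ltnP k n) => [/bu/and3P[_ _ bO]|_]; last by exists 0.
  by exists (Sub (b k)^-1 bO : valring nu).
apply: (isometric_of_expansions (n := n) (d := d) (z := x) (z' := x') hh hh').
- move=> i j lt_i lt_j; apply: val_inj.
  rewrite -(extension_embed hM) -(extension_embed hM').
  by rewrite [LHS]xb // [RHS]xb'.
- exact: (embed_expand sigmaK hM uh b0 dE xb xc).
- exact: (embed_expand sigmaK hM' uh' b0 dE xb' xc').
Qed.
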